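(* Let $p\in\mathbb N$, $\Omega=\mathbb Z_p=\mathbb Z/p\mathbb Z$, and let $T:\Omega\to\Omega$ be given by $T[k]=[k+1]$. Then $$\mathfrak A(\Omega,T)=\frac1p\mathbb Z=\left\{\frac np:n\in\mathbb Z\right\}.$$
   Context: $\mathbb T=\mathbb R/\mathbb Z$; $[k]$ is the residue class of $k$ modulo $p$; $\mathbb Z_p$ carries the discrete topology. The system $(\mathbb Z_p,T)$ is uniquely ergodic with invariant measure $\mu$ the normalized counting measure. For a compact metric space $\Omega$, homeomorphism $T:\Omega\to\Omega$ and $T$-ergodic Borel probability measure $\mu$: the suspension is $X=(\Omega\times\mathbb R)/\!\sim$, where $(\omega,t)\sim(\omega',t')$ iff $(\omega',t')=(T^n\omega,t-n)$ for some $n\in\mathbb Z$, with classes $[\omega,t]$, flow $\overline T^{t}[\omega,s]=[\omega,s+t]$, and $\overline T$-ergodic measure $\overline\mu$ given by $\int_X g\,d\overline\mu=\int_0^1\int_\Omega g[\omega,s]\,d\mu(\omega)\,ds$. $C^\sharp(X,\mathbb T)$ is the group of homotopy classes of continuous maps $X\to\mathbb T$ (pointwise addition). For $\phi\in C(X,\mathbb T)$, $x\in X$, let $\widetilde\phi_x:\mathbb R\to\mathbb R$ be a continuous lift of $t\mapsto\phi(\overline T^{t}x)$. For $\overline\mu$-a.e. $x$, $\lim_{t\to\infty}\widetilde\phi_x(t)/t$ exists and equals a constant depending only on $[\phi]$, denoted $\mathfrak A_{\overline\mu}([\phi])$ (the Schwartzman homomorphism). $\mathfrak A(\Omega,T,\mu)=\mathfrak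 A_{\overline\mu}(C^\sharp(X,\mathbb T))\subseteq\mathbb R$ is its range; when $(\Omega,T)$ is uniquely ergodic one writes $\mathfrak A(\Omega,T)$. *)

(* Defs.v *)
From HB Require Import structures.
From mathcomp Require Import all_boot all_order all_algebra generic_quotient.
From mathcomp Require Import all_classical all_reals all_analysis.

Set Implicit Arguments.
Unset Strict Implicit.
Unset Printing Implicit Defensive.

Import Order.TTheory GRing.Theory Num.Theory.
Import numFieldNormedType.Exports.

Local Open Scope classical_set_scope.
Local Open Scope ring_scope.
Local Open Scope quotient_scope.

Definition borel (X : ptopologicalType) := g_sigma_algebraType (@open X).

Record homeomorphism (X : topologicalType) := Homeomorphism {
  homeo_fun :> X -> X;
  homeo_inv : X -> X;
  homeo_funK : cancel homeo_fun homeo_inv;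
  homeo_invK : cancel homeo_inv homeo_fun;
  homeo_fun_continuous : continuous homeo_fun;
  homeo_inv_continuous : continuous homeo_inv }.

Definition iterz (X : topologicalType) (T : homeomorphism X) (n : int) : X -> X :=
  match n with
  | Posz m => iter m T
  | Negz m => iter m.+1 (homeo_inv T)
  end.

Section iterz_theory.
Context (X : topologicalType) (T : homeomorphism X).

Lemma iterzS n x : iterz T (n + 1) x = T (iterz T n x).
Proof.
case: n => [m|[|m]]; first by rewrite -PoszD addn1.
  by rewrite /= homeo_invK.
have -> : Negz m.+1 + 1 = Negz m by rewrite !NegzE -addn1 PoszD opprD addrNK.
by rewrite /= homeo_invK.
Qed.

Lemma iterzP n x : iterz T (n - 1) x = homeo_inv T (iterz T n x).
Proof. by rewrite -[n in RHS](subrK 1) iterzS homeo_funK. Qed.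

Lemma iterzD m n x : iterz T (m + n) x = iterz T m (iterz T n x).
Proof.
elim/int_ind: m => [|m IH|m IH]; first by rewrite add0r.
  by rewrite -addn1 PoszD addrAC !iterzS IH.
by rewrite -addn1 PoszD opprD addrAC !iterzP IH.
Qed.

Lemma iterzNK n x : iterz T (- n) (iterz T n x) = x.
Proof. by rewrite -iterzD addNr. Qed.

End iterz_theory.

Section circle.
Context (R : realType).

Definition circle_eq (x y : R) := x - y \is a Num.int.

Lemma circle_refl : reflexive circle_eq.
Proof. by move=> x; rewrite /circle_eq subrr. Qed.

Lemma circle_sym : symmetric circle_eq.
Proof. by move=> x y; rewrite /circle_eq -opprB rpredN. Qed.

Lemma circle_trans : transitive circle_eq.
Proof.
by move=> y x z xy yz; rewrite /circle_eq -(subrK y x) -addrA rpredD.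
Qed.

Definition circle_rel : equiv_rel R :=
  EquivRel circle_eq circle_refl circle_sym circle_trans.

Definition circle := {eq_quot circle_rel}.
HB.instance Definition _ := Quotient.on circle.
HB.instance Definition _ := Topological.copy circle (quotient_topology circle).

Definition circle_proj (x : R) : circle := \pi_circle x.

End circle.

Section suspension.
Context (R : realType) (Omega : ptopologicalType) (T : homeomorphism Omega).

Definition susp_eq (x y : Omega * R) :=
  `[< exists n : int, y = (iterz T n x.1, x.2 - n%:~R) >].

Lemma susp_refl : reflexive susp_eq.
Proof. by move=> [w t]; apply/asboolP; exists 0; rewrite /= subr0. Qed.

Lemma susp_sub x y : susp_eq x y -> susp_eq y x.
Proof.
case: x y => [w t] [w' t'] /asboolP[n [-> ->]]; apply/asboolP; exists (- n).
by rewrite /= iterzNK mulrNz opprK subrK.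
Qed.

Lemma susp_sym : symmetric susp_eq.
Proof. by move=> x y; apply/idP/idP; exact: susp_sub. Qed.

Lemma susp_trans : transitive susp_eq.
Proof.
move=> [w' t'] [w t] [w'' t''] /asboolP[n [-> ->]] /asboolP[m [-> ->]].
by apply/asboolP; exists (m + n); rewrite /= iterzD intrD opprD addrA addrAC.
Qed.

Definition susp_rel : equiv_rel (Omega * R)%type :=
  EquivRel susp_eq susp_refl susp_sym susp_trans.

Definition suspension := {eq_quot susp_rel}.
HB.instance Definition _ := Quotient.on suspension.
HB.instance Definition _ :=
  Topological.copy suspension (quotient_topology suspension).
HB.instance Definition _ :=
  isPointed.Build suspension (\pi_suspension (point, 0)).

Definition susp (w : Omega) (s : R) : suspension := \pi_suspension (w, s).

Definition susp_flow (t : R) (x : suspension) : suspension :=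
  susp (repr x).1 ((repr x).2 + t).

Lemma susp_flowE t w s : susp_flow t (susp w s) = susp w (s + t).
Proof.
rewrite /susp_flow /susp; case: piP => -[w' s'] /eqmodP/asboolP[n [-> ->]] /=.
apply/esym/eqmodP/asboolP; exists n => /=; by rewrite addrAC.
Qed.

(* Disintegration over s of the suspension measure, on sets: the formula
   \int g = \int_0^1 \int_Omega g [w, s] dmu(w) ds with g the indicator of A;
   only its null sets are used below. *)
Definition susp_measure (mu : probability (borel Omega) R)
    (A : set (borel suspension)) : \bar R :=
  (\int[lebesgue_measure]_(s in `[0%R, 1%R])
     \int[mu]_w (\1_A (susp w s))%:E)%E.

End suspension.
Arguments suspension R {Omega} T.

Section homotopy.
Context (R : realType) (X Y : topologicalType).

Definition homotopic (f g : continuousType X Y) :=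
  exists H : X * R -> Y,
    [/\ {within [set: X] `*` `[0, 1], continuous H},
        forall x, H (x, 0) = f x & forall x, H (x, 1) = g x].

Definition homotopy_class (f : continuousType X Y) : set (continuousType X Y) :=
  [set g | homotopic f g].

Definition homotopy_classes : set (set (continuousType X Y)) :=
  range homotopy_class.

End homotopy.
Arguments homotopy_classes : clear implicits.

Section schwartzman.
Context (R : realType) (Omega : ptopologicalType) (T : homeomorphism Omega).
Context (mu : probability (borel Omega) R).
Local Notation X := (suspension R T).

Definition orbit_lift (phi : X -> circle R) (x : X) (f : R -> R) :=
  continuous f /\ forall t, circle_proj (f t) = phi (susp_flow t x).

(* Lifts always exist and differ by constants, so it does not matter which
   lift is used. *)
Definition is_schwartzman (c : set (continuousType X (circle R))) (a : R) :=
  forall phi, c phi ->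
    {ae susp_measure mu, forall x : borel X,
      exists2 f : R -> R, orbit_lift phi x f & f t / t @[t --> +oo] --> a}.

(* [0] is a dummy value, for when no limit exists. *)
Definition schwartzman (c : set (continuousType X (circle R))) : R :=
  xget 0 (is_schwartzman c).

Definition schwartzman_range : set R :=
  schwartzman @` homotopy_classes R X (circle R).

End schwartzman.

Section unique_ergodicity.
Context (R : realType) (Omega : ptopologicalType) (T : homeomorphism Omega).
Implicit Types mu nu : probability (borel Omega) R.

Definition invariant mu :=
  forall A : set (borel Omega), measurable A -> mu (T @^-1` A) = mu A.

Definition uniquely_ergodic mu :=
  invariant mu /\ forall nu, invariant nu ->
    forall A : set (borel Omega), measurable A -> nu A = mu A.

End unique_ergodicity.

(* Z/pZ for 0 < p; the form 'I_p.-1.+1 makes the type inhabited for every p. *)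
Definition Zmod (p : nat) := discrete_topology 'I_p.-1.+1.


Section Zmod.
Context (p : nat).

HB.instance Definition _ := Finite.copy (Zmod p) 'I_p.-1.+1.
HB.instance Definition _ := isPointed.Build (Zmod p) (ord0 : 'I_p.-1.+1).
HB.instance Definition _ := DiscreteTopology.on (Zmod p).
HB.instance Definition _ := PointedTopological.copy (Zmod p) (Zmod p).

Lemma Zmod_continuous (f : Zmod p -> Zmod p) : continuous f.
Proof. by apply/continuousP => A _; exact: discrete_open. Qed.

(* [ordS] is k |-> k + 1 mod p. *)
Definition Zmod_rotation : homeomorphism (Zmod p) :=
  @Homeomorphism (Zmod p) (@ordS p.-1.+1) (@ord_pred p.-1.+1)
    (@ordSK p.-1.+1) (@ord_predK p.-1.+1)
    (@Zmod_continuous _) (@Zmod_continuous _).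

Context (R : realType).

Definition Zmod_measure : set (borel (Zmod p)) -> \bar R :=
  mscale (#|{: Zmod p}|%:R^-1)%:nng counting.

HB.instance Definition _ := Measure.on Zmod_measure.

Lemma card_Zmod_neq0 : #|{: Zmod p}|%:R != 0 :> R.
Proof. by rewrite pnatr_eq0 -lt0n; apply/card_gt0P; exists point. Qed.

Lemma Zmod_measureE (A : set (borel (Zmod p))) :
  Zmod_measure A = (#|[pred k : Zmod p | k \in A]|%:R / #|{: Zmod p}|%:R)%:E.
Proof.
rewrite /Zmod_measure /mscale/= /counting asboolT; last exact: finite_finset.
rewrite -EFinM mulrC; congr (_%:R * _)%:E.
rewrite cardE; apply: perm_size; apply: uniq_perm; rewrite ?enum_uniq//.
move=> k; rewrite mem_enum inE [LHS]in_fset_set ?inE//; exact: finite_finset.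
Qed.

Lemma Zmod_measureT : Zmod_measure setT = 1%E.
Proof.
rewrite Zmod_measureE (_ : #|_| = #|{: Zmod p}|) ?divff ?card_Zmod_neq0//.
by apply: eq_card => k; rewrite unfold_in /= in_setT.
Qed.

HB.instance Definition _ :=
  Measure_isProbability.Build _ _ _ Zmod_measure Zmod_measureT.

Lemma Zmod_measurable (A : set (borel (Zmod p))) : measurable A.
Proof. by apply: sub_sigma_algebra; exact: discrete_open. Qed.

Lemma Zmod_probability_sum (nu : probability (borel (Zmod p)) R)
  (A : set (borel (Zmod p))) : nu A = (\sum_(k \in A) nu [set k])%E.
Proof.
rewrite -[in LHS](image_id A) -(bigcup_imset1 A id).
apply: measure_fin_bigcup => //; first exact: finite_finset.
  by move=> i j _ _ [x [-> ->]].
by move=> i _; exact: Zmod_measurable.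
Qed.

Lemma Zmod_probability_set1 (nu : probability (borel (Zmod p)) R) (k : Zmod p) :
  invariant Zmod_rotation nu -> nu [set k] = (#|{: Zmod p}|%:R^-1)%:E.
Proof.
move=> nuT.
have fin (j : Zmod p) : nu [set j] \is a fin_num.
  by rewrite fin_num_measure//; exact: Zmod_measurable.
have nuS (j : Zmod p) : nu [set Zmod_rotation j] = nu [set j].
  rewrite -nuT; last exact: Zmod_measurable.
  congr (nu _); apply/seteqP; split=> i /=; last by move=> ->.
  exact: ordS_inj.
have nu0 (j : 'I_p.-1.+1) : nu [set j] = nu [set ord0].
  case: j; elim=> [|m IH] lt_m; first by congr (nu [set _]); exact: val_inj.
  rewrite -(IH (ltnW lt_m)) -[RHS]nuS; congr (nu [set _]); apply: val_inj => /=.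
  by rewrite modn_small.
have := probability_setT nu; rewrite Zmod_probability_sum.
rewrite (fsbigE (enum {: Zmod p}))//; last 2 first.
- exact: enum_uniq.
- by move=> i _; rewrite mem_enum.
rewrite (eq_bigr (fun=> (fine (nu [set k]))%:E)); last first.
  by move=> i _; rewrite fineK// (nu0 i) (nu0 k).
rewrite sumEFin big_mkcond/= (eq_bigr (fun=> fine (nu [set k]))); last first.
  by move=> i _; rewrite in_setT.
rewrite big_enum/= sumr_const => -[] /(congr1 (fun x => x / #|{: Zmod p}|%:R)).
rewrite -[_ *+ _]mulr_natr mulfK ?card_Zmod_neq0// mul1r => <-.
by rewrite fineK.
Qed.

Lemma Zmod_invariant : invariant Zmod_rotation Zmod_measure.
Proof.
move=> A _; rewrite [LHS]Zmod_measureE [RHS]Zmod_measureE; congr (_%:R / _)%:E.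
transitivity #|[preim Zmod_rotation of [pred k : Zmod p | k \in A]]|.
  by apply: eq_card => k; rewrite !inE.
rewrite card_preim; last exact: ordS_inj.
apply: eq_card => k; rewrite !inE; case: (k \in A); rewrite ?andbF// andbT.
by apply/codomP; exists (@ord_pred p.-1.+1 k); rewrite /= ord_predK.
Qed.

Lemma Zmod_uniquely_ergodic : uniquely_ergodic Zmod_rotation Zmod_measure.
Proof.
split=> [|nu nuT A _]; first exact: Zmod_invariant.
rewrite [LHS]Zmod_probability_sum [RHS]Zmod_probability_sum; apply: eq_fsbigr => k _.
by rewrite !Zmod_probability_set1//; exact: Zmod_invariant.
Qed.

End Zmod.
Arguments Zmod_measure : clear implicits.

(* Main.v *)
(* A flow orbit in X closes up after time p, so a lift f of a map along it satisfies
   f (t + p) = f t + n with n an integer, and its slope can only be n / p.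
   Conversely [w, s] |-> n (w + s) / p is a well-defined map to the circle whose lifts
   have slope n / p.  The slope is a homotopy invariant: as X is compact, nearby
   stages of a homotopy are uniformly within 1/2 of each other, so a lift of one
   yields a lift of the other at bounded distance, and [0, 1] is connected. *)
From HB Require Import structures.
Require Import Defs.
From mathcomp Require Import all_boot all_order all_algebra generic_quotient.
From mathcomp Require Import all_classical all_reals all_analysis.
From mathcomp Require Import ring lra zify.

Set Implicit Arguments.
Unset Strict Implicit.
Unset Printing Implicit Defensive.

Import Order.TTheory GRing.Theory Num.Theory.
Import numFieldNormedType.Exports.

Local Open Scope classical_set_scope.
Local Open Scope ring_scope.
Local Open Scope quotient_scope.

(** * The circle and lifts to the line *)

Section circle_theory.
Context (R : realType).
Implicit Types a b : R.

Lemma circle_projP a b :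
  reflect (circle_proj a = circle_proj b) (a - b \is a Num.int).
Proof. by apply: (iffP idP) => [h|/eqmodP//]; exact/eqmodP. Qed.

Lemma circle_projK (c : circle R) : circle_proj (repr c) = c.
Proof. exact: reprK. Qed.

Lemma continuous_circle_proj : continuous (@circle_proj R).
Proof. exact: pi_continuous. Qed.

Lemma open_circle_proj (U : set R) : open U -> open (@circle_proj R @` U).
Proof.
move=> oU; rewrite /open/= /quotient_open.
have -> : \pi_(circle R) @^-1` (@circle_proj R @` U) =
    \bigcup_(n in [set: int]) ((fun x => x + n%:~R) @^-1` U).
  apply/seteqP; split=> [x /= [y Uy /circle_projP/intrP[n yx]]|x [n _ /= Un]].
    by exists n => //=; rewrite -yx addrC subrK.
  by exists (x + n%:~R) => //; apply/circle_projP; rewrite addrC addKr intr_int.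
apply: bigcup_open => n _.
have /continuousP : continuous (fun x : R => x + n%:~R).
  by move=> x; apply: cvgD; [exact: cvg_id|exact: cvg_cst].
by apply.
Qed.

(** Two points of an open interval of length 1 differ by less than 1, so an integer difference is
    0. *)
Lemma circle_proj_inj_ball (a x y : R) : `|x - a| < 1 / 2 -> `|y - a| < 1 / 2 ->
  circle_proj x = circle_proj y -> x = y.
Proof.
rewrite !ltr_norml => ? ? /circle_projP/intrP[n xy].
suff n0 : n = 0 by move: xy; rewrite n0 => /eqP; rewrite subr_eq0 => /eqP.
have : (-1)%:~R < (n%:~R : R) < 1%:~R.
  by rewrite -xy; rewrite mulrNz; apply/andP; split; lra.
by rewrite !ltr_int; lia.
Qed.

(* The perturbed lift picks the unique representative within [1/2] of [f], which
   dispenses with any path-lifting theorem. *)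
Lemma lift_perturb (X : topologicalType) (f : X -> R) (g : X -> circle R) :
  continuous f -> continuous g ->
  (forall x, exists2 y, circle_proj y = g x & `|y - f x| < 1 / 2) ->
  exists f' : X -> R, [/\ continuous f', forall x, circle_proj (f' x) = g x
    & forall x, `|f' x - f x| < 1 / 2].
Proof.
move=> cf cg fg.
have /choice[f' f'P] : forall x, exists y,
    circle_proj y = g x /\ `|y - f x| < 1 / 2.
  by move=> x; have [y ? ?] := fg x; exists y.
have f'g x : circle_proj (f' x) = g x by have [] := f'P x.
have f'f x : `|f' x - f x| < 1 / 2 by have [] := f'P x.
exists f'; split => // x.
apply/cvgrPdist_lt => e e0.
(* Half of the slack between [f' x] and the bound 1/2: a point [y] of the [d]-ball around [f' x] is
   then still within 1/2 of [f z], and being a representative of [g z] it must equal [f' z]. *)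
pose d := Num.min e ((1 / 2 - `|f' x - f x|) / 2).
have d0 : 0 < d by rewrite lt_min e0/= divr_gt0// subr_gt0.
have de : d <= e by rewrite ge_min lexx.
have dh : d <= (1 / 2 - `|f' x - f x|) / 2 by rewrite ge_min lexx orbT.
have fd : \forall z \near x, `|f x - f z| < d by move/cvgrPdist_lt: (cf x); exact.
have gd : \forall z \near x, (@circle_proj R @` ball (f' x) d) (g z).
  apply: (cg x); apply: open_nbhs_nbhs; split.
    exact/open_circle_proj/ball_open.
  by exists (f' x) => //; exact: ballxx.
near=> z.
have [y yd yg] : (@circle_proj R @` ball (f' x) d) (g z) by near: z.
have fz : `|f x - f z| < d by near: z.
suff <- : y = f' z by apply: (lt_le_trans _ de).
apply: (@circle_proj_inj_ball (f z)) => //; last by rewrite f'g.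
have -> : y - f z = (y - f' x) + (f' x - f x) + (f x - f z) by ring.
have yd' : `|y - f' x| < d by rewrite distrC.
apply: (le_lt_trans (ler_normD _ _)).
apply: (le_lt_trans (lerD (ler_normD _ _) (lexx _))).
set u := `|y - _| in yd' *; set v := `|f' x - _| in dh *; lra.
Unshelve. all: end_near. Qed.

(** Distance below 1/2 on the circle, that is, not being antipodal, expressed through
    representatives. *)
Definition circle_close (c c' : circle R) :=
  exists x y : R, [/\ circle_proj x = c, circle_proj y = c' & `|y - x| < 1 / 2].

Lemma circle_closeC c c' : circle_close c c' -> circle_close c' c.
Proof. by move=> [x [y [? ? ?]]]; exists y, x; rewrite distrC. Qed.

(** Shifting both witnesses by one integer lets the first representative be prescribed, here as the
    value of a given lift. *)
Lemma circle_close_ball (x : R) c : circle_close (circle_proj x) c ->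
  exists2 y, circle_proj y = c & `|y - x| < 1 / 2.
Proof.
move=> [a [b [/circle_projP ax <- ba]]]; exists (b - (a - x)).
  by apply/circle_projP; rewrite addrC addKr rpredN.
by have -> : b - (a - x) - x = b - a by ring.
Qed.

Lemma near_circle_close (c : circle R) :
  exists2 U, nbhs c U & forall c1 c2, U c1 -> U c2 -> circle_close c1 c2.
Proof.
(* Radius 1/4 puts any two points of the ball within 1/2 of each other. *)
exists (@circle_proj R @` ball (repr c) (1 / 4)).
  apply: open_nbhs_nbhs; split; first exact/open_circle_proj/ball_open.
  by exists (repr c); [apply: ballxx; lra|exact: circle_projK].
move=> _ _ [x xc <-] [y yc <-]; exists x, y; split=> //.
move: xc yc; rewrite /ball/= !ltr_norml => ? ?; apply/andP; split; lra.
Qed.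

(** The level set of [f 0] is closed, and open because integers at distance below 1 coincide; the
    line is connected. *)
Lemma continuous_int_cst (f : R -> R) :
  continuous f -> (forall t, f t \is a Num.int) -> forall t, f t = f 0.
Proof.
move=> cf fZ t.
pose Z := [set t | f t = f 0].
suff : Z = [set: R] by move/seteqP => [_ /(_ t I)].
have /connected_intervalP : is_interval [set: R] by [].
apply; first by exists 0.
- exists (f @^-1` ball (f 0) 1).
    by move/continuousP: cf; apply; exact: ball_open.
  rewrite setTI; apply/seteqP; split=> [u /= ->|u /=]; first exact: ballxx.
  rewrite /ball/= -normrN opprB => fu; apply/eqP; rewrite -subr_eq0.
  have /intrP[n fn] : f u - f 0 \is a Num.int by rewrite rpredB.
  move: fu; rewrite fn -intr_norm -[1]/(1%:~R) ltr_int => n1.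
  by rewrite intr_eq0; lia.
- exists Z; last by rewrite setTI.
  by apply: (@closed_comp _ _ f [set x | x = f 0]) => [u _|];
    [exact: cf|exact: closed_eq].
Qed.

End circle_theory.

(** * Asymptotic slopes of real functions *)

Section slope.
Context (R : realType).

(** The slopes differ by at most [C / t], which tends to 0. *)
Lemma cvg_slope_bounded (f g : R -> R) (C a : R) :
  (forall t, `|g t - f t| <= C) ->
  f t / t @[t --> +oo] --> a -> g t / t @[t --> +oo] --> a.
Proof.
move=> gf fa.
have Vt : (t^-1 : R) @[t --> +oo] --> (0 : R).
  have [|_ +] := @gtr0_cvgV0 R R (pinfty_nbhs R) _ id.
    by near=> t; near: t; exact: nbhs_pinfty_gt.
  by apply; exact: cvg_id.
have gf0 : (g t - f t) / t @[t --> +oo] --> (0 : R).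
  apply/norm_cvg0P; apply: (@squeeze_cvgr _ _ _ _ (fun=> 0) (fun t => C * t^-1)).
  - near=> t; rewrite normr_ge0/= normrM [X in _ * X]ger0_norm.
      by apply: ler_wpM2r; rewrite ?invr_ge0.
    by rewrite invr_ge0.
  - exact: cvg_cst.
  - by rewrite -(mulr0 C); apply: cvgM => //; exact: cvg_cst.
have h := cvgD fa gf0; rewrite addr0 in h.
suff -> : (fun t => g t / t) = (fun t => f t / t + (g t - f t) / t) by exact: h.
by apply/funext => t /=; rewrite -mulrDl addrCA subrr addr0.
Unshelve. all: end_near. Qed.

(** On the multiples of [P], [f] agrees with the affine function [c / P * t + f 0], so the limit can
    be computed along that sequence. *)
Lemma quasiperiodic_slope (f : R -> R) (P c a : R) : 0 < P ->
  (forall t, f (t + P) = f t + c) -> f t / t @[t --> +oo] --> a -> a = c / P.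
Proof.
move=> P0 fP fa.
have fk (k : nat) : f (k%:R * P) = k%:R * c + f 0.
  elim: k => [|k IH]; first by rewrite !mul0r add0r.
  by rewrite -natr1 mulrDl mul1r fP IH mulrDl mul1r addrAC.
have kP : (k%:R * P : R) @[k --> \oo] --> +oo.
  exact: (cvg_comp _ _ cvgr_idn (gt0_cvgMly P0 cvg_id)).
have /cvg_pinftyP/(_ _ kP) fka := fa.
apply: (cvg_unique _ fka); first exact: norm_hausdorff.
have gb : (c / P * t + f 0) / t @[t --> +oo] --> c / P.
  apply: (@cvg_slope_bounded (fun t => c / P * t) _ `|f 0|).
    by move=> t; rewrite addrAC subrr add0r.
  by apply: cvg_near_cst; near=> t; rewrite mulfK//; apply: lt0r_neq0.
have /cvg_pinftyP/(_ _ kP) h := gb.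
suff -> : (fun k => f (k%:R * P) / (k%:R * P)) =
  (fun k => (c / P * (k%:R * P) + f 0) / (k%:R * P)) by exact: h.
apply/funext => k; rewrite fk; congr ((_ + _) / _).
by field; exact: lt0r_neq0.
Unshelve. all: end_near. Qed.

End slope.

(** * Topology of the suspension *)

Section suspension_theory.
Context (R : realType) (Omega : ptopologicalType) (T : homeomorphism Omega).
Local Notation X := (suspension R T).

Lemma suspP (x : X) : exists w s, x = susp T w s.
Proof.
exists (repr x).1, (repr x).2.
by rewrite /susp -surjective_pairing reprK.
Qed.

Lemma susp_iterz (n : int) w (s : R) : susp T (iterz T n w) s = susp T w (s + n%:~R).
Proof.
by apply/esym/eqmodP/asboolP; exists n; rewrite /= addrK.
Qed.

(** The flow is defined through [repr], which need not be continuous; with one representative fixed,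
    the orbit is a translation followed by the projection. *)
Lemma continuous_susp_flow (x : X) : continuous (fun t : R => susp_flow t x).
Proof.
have [w [s ->]] := suspP x => t.
under eq_fun do rewrite susp_flowE.
apply: (@continuous_comp _ _ _ (fun t => (w, s + t)) (\pi_X)); last exact: pi_continuous.
apply: (@cvg_pair _ _ _ _ (nbhs w) (nbhs (s + t))); first exact: cvg_cst.
by apply: cvgD; [exact: cvg_cst|exact: cvg_id].
Qed.

Lemma compact_suspension :
  compact [set: Omega] -> compact [set: X].
Proof.
move=> cO; rewrite (_ : [set: X] = \pi_X @` ([set: Omega] `*` `[0, 1])).
  apply: continuous_compact; last by apply: compact_setX => //; exact: segment_compact.
  by apply: continuous_subspaceT; exact: pi_continuous.
apply/seteqP; split=> // x _; have [w [s ->]] := suspP x.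
(* Trading the integer part of [s] for iterates of [T] brings the point into the fundamental
   domain. *)
exists (iterz T (Num.floor s) w, s - (Num.floor s)%:~R).
  split=> //=; rewrite in_itv/= subr_ge0 floor_le/= lerBlDr.
  by rewrite -[1]/(1%:~R) -intrD addrC ltW// floorD1_gt.
by rewrite -[LHS]/(susp T _ _) susp_iterz subrK.
Qed.

End suspension_theory.

(** * Homotopy invariance and possible values of the slope *)

Section homotopy_invariance.
Context (R : realType) (Omega : ptopologicalType) (T : homeomorphism Omega).
Local Notation X := (suspension R T).

Lemma homotopic_refl (Y Z : topologicalType) (f : continuousType Y Z) :
  homotopic R f f.
Proof.
exists (fun z => f z.1); split=> //; apply: continuous_subspaceT => z.
by apply: continuous_comp; [exact: cvg_fst|exact: cts_fun].
Qed.

(** A tube-lemma argument: compactness makes the neighbourhood of [r] uniform in [x]. *)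
Lemma homotopy_close (H : X * R -> circle R) (r : R) :
  compact [set: X] -> {within [set: X] `*` `[0, 1], continuous H} -> `[0, 1]%classic r ->
  \forall r' \near within `[0, 1] (nbhs r),
    forall x, circle_close (H (x, r)) (H (x, r')).
Proof.
move=> /compact_near_coveringP cX /subspace_continuousP cH r01.
suff : \forall r' \near within `[0, 1] (nbhs r),
    [set: X] `<=` (fun x => circle_close (H (x, r)) (H (x, r'))).
  by apply: filterS => r' h x; exact: h.
apply: cX => x _.
have [U /= Uc UU] := near_circle_close (H (x, r)).
have /= := cH (x, r) (conj I r01) _ Uc.
rewrite /fmap/= => -[[A B]/= [xA rB] ABU].
(* As [r] itself lies in [B], both [H (x', r)] and [H (x', r')] fall into [U], whose points are
   pairwise close. *)
have Br := nbhs_singleton rB; exists (A, [set r' | B r' /\ `[0, 1]%classic r']) => /=.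
  split=> //; rewrite /within/=; near_simpl.
  by apply: filterS rB => r' Br' r'01; split.
move=> [x' r'] /= [Ax' [Br' r'01]].
by apply: UU; apply: ABU.
Qed.

Lemma homotopic_slope (phi psi : continuousType X (circle R)) (x : X) (a : R) :
  compact [set: X] -> homotopic R phi psi ->
  (exists2 f, orbit_lift phi x f & f t / t @[t --> +oo] --> a) ->
  exists2 f, orbit_lift psi x f & f t / t @[t --> +oo] --> a.
Proof.
move=> cX [H [cH H0 H1]] phif.
have cHr (r : R) : `[0, 1]%classic r -> continuous (fun y => H (y, r)).
  move/subspace_continuousP : cH => cH r01 y.
  apply: cvg_trans (cH (y, r) (conj I r01)).
  move=> U [[A B]/= [yA rB] ABU]; rewrite /fmap/=.
  apply: filterS yA => y' Ay'; apply: ABU; split=> //=; exact: nbhs_singleton.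
pose good r := exists2 f, orbit_lift (fun y => H (y, r)) x f &
  f t / t @[t --> +oo] --> a.
have good_close (r r' : R) : `[0, 1]%classic r' ->
    (forall y, circle_close (H (y, r)) (H (y, r'))) -> good r -> good r'.
  move=> r'01 rr' [f [cf fH] fa].
  have cg : continuous (fun t => H (susp_flow t x, r')).
    move=> t; apply: (@continuous_comp _ _ _ (fun t => susp_flow t x)
      (fun y => H (y, r'))); [exact: continuous_susp_flow|exact: cHr].
  have [|f' [cf' f'H f'f]] := lift_perturb cf cg.
    by move=> t; apply: circle_close_ball; rewrite fH.
  exists f'; first by split.
  by apply: cvg_slope_bounded fa => t; exact/ltW/f'f.
have goodE (r : R) : `[0, 1]%classic r ->
    \forall r' \near r, `[0, 1]%classic r' -> (good r <-> good r').
  move=> r01.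
  have : nbhs r [set r' | `[0, 1]%classic r' ->
    forall y, circle_close (H (y, r)) (H (y, r'))] := homotopy_close cX cH r01.
  apply: filterS => r' h r'01; split; apply: good_close => //; first exact: h.
  by move=> y; apply: circle_closeC; exact: h.
have good0 : good 0 by have [f [cf fH] fa] := phif; exists f => //; split=> // t; rewrite H0.
have in0 : `[0, 1]%classic (0 : R) by rewrite /= in_itv/= lexx ler01.
have in1 : `[0, 1]%classic (1 : R) by rewrite /= in_itv/= lexx ler01.
(* [good] is locally constant on [0, 1], hence clopen there. *)
have : `[0, 1]%classic `&` good = `[0, 1]%classic.
  apply: (@segment_connected R 0 1); first by exists 0.
  (* Nothing is known of [H] outside [0, 1], so the witness open in the line tests [good] only at
     nearby points of [0, 1]. The closed witness below is the complement of the analogous set for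
     [~ good]. *)
  - exists ([set r | \forall r' \near r, `[0, 1]%classic r' -> good r']°).
      exact: open_interior.
    apply/seteqP; split=> r /= [r01].
      move=> gr; split=> //; rewrite /interior/=; apply: nbhs_interior.
      by apply: filterS (goodE _ r01) => r' h /h[+ _]; exact.
    by move=> /interior_subset /nbhs_singleton h; split=> //; exact: h.
  - exists (~` [set r | \forall r' \near r, `[0, 1]%classic r' -> ~ good r']°).
      by apply: open_closedC; exact: open_interior.
    apply/seteqP; split=> r /= [r01].
      by move=> gr; split=> // /interior_subset /nbhs_singleton; exact.
    move=> nr; split=> //; apply: contrapT => ngr; apply: nr.
    rewrite /interior/=; apply: nbhs_interior.
    by apply: filterS (goodE _ r01) => r' h /h[_ +] => h' /h'.
move/seteqP => [_ /(_ _ in1)[_ [f [cf fH] fa]]].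
by exists f => //; split=> // t; rewrite fH H1.
Qed.

Lemma schwartzman_homotopy_class (mu : probability (borel Omega) R)
    (phi : continuousType X (circle R)) (a : R) :
  compact [set: X] ->
  (forall x, exists2 f, orbit_lift phi x f & f t / t @[t --> +oo] --> a) ->
  is_schwartzman mu (homotopy_class R phi) a.
Proof.
(* The slope exists along every orbit, so the exceptional set is empty. *)
move=> cX phia psi phipsi; exists set0; split=> //.
  rewrite /susp_measure; under eq_integral do under eq_integral do rewrite indic0.
  by under eq_integral do rewrite integral0; rewrite integral0.
move=> x /=; apply; exact: homotopic_slope (phia x).
Qed.

(** Extracts an actual orbit from an almost-everywhere statement: otherwise the null set would be
    all of X, which has measure 1. *)
Lemma is_schwartzman_lift (mu : probability (borel Omega) R)
    (phi : continuousType X (circle R)) (a : R) :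
  is_schwartzman mu (homotopy_class R phi) a ->
  exists x f, orbit_lift phi x f /\ f t / t @[t --> +oo] --> a.
Proof.
move=> /(_ phi (homotopic_refl phi)) [N [_ N0 subN]]; apply: contrapT => no.
have NT : N = setT.
  by apply/seteqP; split=> // x _; apply: subN => -[f ? ?]; apply: no; exists x, f.
have int1 (s : R) : (\int[mu]_w (\1_[set: X] (susp T w s))%:E = 1)%E.
  rewrite -[RHS](probability_setT mu) -[RHS]mul1e -integral_cst//.
  by apply: eq_integral => w _; rewrite indicT.
move: N0; rewrite NT /susp_measure; under eq_integral do rewrite int1.
rewrite integral_cst//= mul1e lebesgue_measure_itv/= lte_fin ltr01 sube0.
by move=> [] /eqP; rewrite oner_eq0.
Qed.

Lemma periodic_schwartzman (mu : probability (borel Omega) R)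
    (phi : continuousType X (circle R)) (p : nat) (a : R) :
  (0 < p)%N -> (forall w, iter p T w = w) ->
  is_schwartzman mu (homotopy_class R phi) a ->
  exists n : int, a = n%:~R / p%:R.
Proof.
move=> p0 Tp /is_schwartzman_lift[x [f [[cf fphi] fa]]].
have P0 : 0 < p%:R :> R by rewrite ltr0n.
have flowp t : susp_flow (t + p%:R) x = susp_flow t x.
  have [w [s ->]] := suspP x.
  by rewrite !susp_flowE addrA -(susp_iterz T p) /= Tp.
(* Since the orbit closes up after time [p], [g] is integer-valued, hence constant: it is the degree
   of [phi] along the closed orbit. *)
pose g t := f (t + p%:R) - f t.
have cg : continuous g.
  move=> t; apply: cvgB; last exact: cf.
  apply: (@cvg_comp _ _ _ (fun t => t + p%:R) f _ (nbhs (t + p%:R))); last exact: cf.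
  by apply: cvgD; [exact: cvg_id|exact: cvg_cst].
have gZ t : g t \is a Num.int by apply/circle_projP; rewrite !fphi flowp.
have /intrP[n gn] := gZ 0; exists n.
apply: (quasiperiodic_slope P0 _ fa) => t.
by rewrite -gn -(continuous_int_cst cg gZ t) [RHS]addrC subrK.
Qed.

(** Two lifts along the same orbit differ by a constant, so they have the same slope. This pins down
    the value that [xget] selects. *)
Lemma is_schwartzman_unique (mu : probability (borel Omega) R)
    (phi : continuousType X (circle R)) (a b : R) :
  (forall x, exists2 f, orbit_lift phi x f & f t / t @[t --> +oo] --> a) ->
  is_schwartzman mu (homotopy_class R phi) b -> b = a.
Proof.
move=> phia /is_schwartzman_lift[x [f [[cf fphi] fb]]].
have [g [cg gphi] ga] := phia x.
have fgZ t : f t - g t \is a Num.int by apply/circle_projP; rewrite fphi gphi.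
have cfg : continuous (fun t => f t - g t).
  by move=> t; apply: cvgB; [exact: cf|exact: cg].
have fga : f t / t @[t --> +oo] --> a.
  apply: (@cvg_slope_bounded _ g f `|f 0 - g 0|) ga => t.
  by rewrite (continuous_int_cst cfg fgZ t).
by apply: (cvg_unique _ fb fga); exact: norm_hausdorff.
Qed.

End homotopy_invariance.

(** * The rotation of [Zmod p] and its winding maps *)

Section Zmod_suspension.
Context (R : realType) (p : nat) (p_gt0 : (0 < p)%N).
Local Notation X := (suspension R (Zmod_rotation p)).

Definition Zmod_val (w : Zmod p) : nat := nat_of_ord (w : 'I_p.-1.+1).

Lemma Zmod_val_rotation (w : Zmod p) :
  Zmod_val (Zmod_rotation p w) = ((Zmod_val w).+1 %% p)%N.
Proof. by rewrite -[LHS]/((Zmod_val w).+1 %% p.-1.+1)%N prednK. Qed.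

Lemma Zmod_val_lt (w : Zmod p) : (Zmod_val w < p)%N.
Proof. by rewrite -[ltnRHS](prednK p_gt0) ltn_ord. Qed.

Lemma Zmod_iter_rotation (w : Zmod p) : iter p (Zmod_rotation p) w = w.
Proof.
have val_iter m : Zmod_val (iter m (Zmod_rotation p) w) = ((Zmod_val w + m) %% p)%N.
  elim: m => [|m IH].
    by rewrite addn0 modn_small// Zmod_val_lt.
  by rewrite iterS Zmod_val_rotation IH -addn1 modnDml addn1 addnS.
apply: val_inj; rewrite -[LHS]/(Zmod_val _) val_iter modnDr modn_small//.
exact: Zmod_val_lt.
Qed.

Lemma Zmod_val_iterz (m : int) (w : Zmod p) :
  exists k : int, (Zmod_val (iterz (Zmod_rotation p) m w) : int) =
    (Zmod_val w : int) + m + k * p%:Z.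
Proof.
have valT v : exists k : int,
    (Zmod_val (Zmod_rotation p v) : int) = (Zmod_val v : int) + 1 + k * p%:Z.
  rewrite Zmod_val_rotation; exists (- ((Zmod_val v).+1 %/ p)%N%:Z).
  by have := divn_eq (Zmod_val v).+1 p; lia.
elim/int_ind: m => [|m [k IH]|m [k IH]]; first by exists 0; rewrite mul0r !addr0.
  rewrite -addn1 PoszD iterzS; have [l ->] := valT (iterz (Zmod_rotation p) m w).
  by exists (k + l); rewrite IH; ring.
(* One rotation takes the iterate at [- m.+1] to the one at [- m], so [valT] is solved backwards. *)
have := iterzS (Zmod_rotation p) (- m.+1%:Z) w.
have -> : - m.+1%:Z + 1 = - m%:Z by lia.
move=> mw; have [l] := valT (iterz (Zmod_rotation p) (- m.+1%:Z) w).
by rewrite -mw IH => kl; exists (k - l); rewrite mulrBl; lia.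
Qed.

Definition winding_lift (n : int) (x : Zmod p * R) : R :=
  n%:~R / p%:R * ((Zmod_val x.1)%:R + x.2).

Definition winding (n : int) : X -> circle R :=
  (fun x => circle_proj (winding_lift n x)) \o repr.

(** Changing the representative changes [w + s] by a multiple [k * p], since the shift of [s] by [m]
    cancels; the lift thus moves by the integer [n * k]. *)
Lemma winding_compat n (x y : Zmod p * R) : \pi_X x = \pi_X y ->
  circle_proj (winding_lift n x) = circle_proj (winding_lift n y).
Proof.
case: x => w s /eqmodP/asboolP[m ->].
have [k kE] := Zmod_val_iterz m w.
apply/circle_projP/intrP; exists (- n * k).
rewrite /winding_lift/= -[(Zmod_val (iterz _ _ _))%:R]/((Zmod_val _)%:Z%:~R) kE.
rewrite !intrD !intrM !rmorphN/= !pmulrn; field.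
by rewrite pnatr_eq0 -lt0n.
Qed.

Lemma windingE n w s : winding n (susp _ w s) = circle_proj (winding_lift n (w, s)).
Proof. by apply: winding_compat; rewrite reprK. Qed.

Lemma continuous_winding n : continuous (winding n).
Proof.
apply: repr_comp_continuous => [|x y /eqP xy]; last exact/eqP/winding_compat.
move=> x; apply: (@continuous_comp _ _ _ (winding_lift n) (@circle_proj R)).
  apply: cvgM; first exact: cvg_cst.
  apply: cvgD; last exact: cvg_snd.
  apply: (@continuous_comp _ _ _ fst (fun w : Zmod p => (Zmod_val w)%:R : R)).
    exact: cvg_fst.
  by move: (x.1); apply/continuousP => A _; exact: discrete_open.
exact: continuous_circle_proj.
Qed.

(** Along an orbit the explicit lift is affine in [t] with slope [n / p]. *)
Lemma winding_slope n (x : X) :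
  exists2 f, orbit_lift (winding n) x f & f t / t @[t --> +oo] --> (n%:~R / p%:R : R).
Proof.
have [w [s ->]] := suspP x.
exists (fun t => winding_lift n (w, s + t)).
  split; last by move=> t; rewrite susp_flowE windingE.
  move=> t; apply: cvgM; first exact: cvg_cst.
  apply: cvgD; first exact: cvg_cst.
  by apply: cvgD; [exact: cvg_cst|exact: cvg_id].
apply: (@cvg_slope_bounded _ (fun t => n%:~R / p%:R * t) _
  `|n%:~R / p%:R * ((Zmod_val w)%:R + s)|).
  by move=> t; rewrite -mulrBr /= !addrA addrK.
apply: cvg_near_cst; near=> t; rewrite mulfK//.
by apply: lt0r_neq0.
Unshelve. all: end_near. Qed.

End Zmod_suspension.

Theorem proposition6p1 (R : realType) (p : nat) (p_gt0 : (0 < p)%N) :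
  schwartzman_range (Zmod_rotation p) (Zmod_measure p R) =
  [set n%:~R / p%:R | n in [set: int]].
Proof.
have cX : compact [set: suspension R (Zmod_rotation p)].
  by apply/compact_suspension/finite_compact/finite_finset.
apply/seteqP; split=> [_ [_ [phi _ <-] <-]|_ [n _ <-]].
  (* If no slope exists, the dummy value 0 is still of the required form, as 0 / p. *)
  rewrite /schwartzman; case: xgetP => [a _|_]; last by exists 0; rewrite // mul0r.
  case/(periodic_schwartzman p_gt0) => [w|n ->]; last by exists n.
  exact: Zmod_iter_rotation.
pose phi : continuousType (suspension R (Zmod_rotation p)) (circle R) :=
  HB.pack (winding n : suspension R (Zmod_rotation p) -> circle R)
    (isContinuous.Build _ _ _ (@continuous_winding R p p_gt0 n)).
exists (homotopy_class R phi); first by exists phi.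
(* Whatever [xget] picks equals [n / p] by uniqueness, and its default case is excluded because
   [n / p] qualifies. *)
rewrite /schwartzman; case: xgetP => [a _|/(_ (n%:~R / p%:R))[]].
  exact/is_schwartzman_unique/winding_slope.
exact/schwartzman_homotopy_class/winding_slope.
Qed.
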